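(* Let $G$ be a finite abelian group of order $mn$, let $N$ be a subgroup of $G$ of order $n$, let $R$ be a subset of $G$ with $|R| = k$, and let $\lambda$ be an integer satisfying $k(k-1) = \lambda n(m-1)$. Then $R$ is an $(m,n,k,\lambda)$ relative difference set in $G$ relative to $N$ if and only if \[ |\chi(R)|^2 = \begin{cases} k-\lambda n & \text{for all } \chi \in N^\perp \setminus G^\perp, \\ k & \text{for all characters } \chi \text{ of } G \text{ with } \chi \notin N^\perp. \end{cases} \]
   Context: The group $G$ is finite and abelian, written multiplicatively. For a group $G$ of order $mn$ and a subgroup $N$ of order $n$, a $k$-subset $R$ of $G$ is an $(m,n,k,\lambda)$ relative difference set in $G$ relative to $N$ if the multiset $\{\{ xy^{-1} \mid x,y \in R,\ x \ne y \}\}$ contains each element of $G \setminus N$ exactly $\lambda$ times and contains no nonidentity element of $N$ (equivalently, $R R^{(-1)} = k + \lambda(G-N)$ in the group ring $\mathbb{Z}[G]$, where a subset of $G$ is identified with the formal sum of its elements, the integer $k$ stands for $k \cdot 1_G$, and $R^{(-1)} = \sum_{g\in R} g^{-1}$). A character of $G$ is a group homomorphism $\chi$ from $G$ to the multiplicative group $\mathbb{C}^*$ of the complex field; $\widehat{G}$ denotes the set of all characters of $G$. For a subgroup $N$ of $G$, $N^\perp = \{ \chi \in \widehat{G} \mid \chi(g) = 1 \text{ for all } g \in N \}$; in particular $G^\perp$ consists only of the principal character (the character mapping every element of $G$ to $1$). For a subset $R \subseteq G$, the character sum of $\chi$ on $R$ is $\chi(R) = \sum_{g \in R} \chi(g)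 \in \mathbb{C}$. *)

(* Defs.v *)
From HB Require Import structures.
From mathcomp Require Import all_boot all_order all_algebra all_fingroup.
From mathcomp Require Import reals.
From mathcomp Require Export complex.

Set Implicit Arguments.
Unset Strict Implicit.
Unset Printing Implicit Defensive.

Import GRing.Theory Num.Theory.
Local Open Scope ring_scope.

Section RelativeDifferenceSets.

Variable gT : finGroupType.

(* Multiplicity of g in the multiset {{ x y^-1 | x, y \in R, x <> y }}. *)
Definition diff_mult (R : {set gT}) (g : gT) : nat :=
  #|[set p in setX R R | (p.1 != p.2) && ((p.1 * p.2^-1)%g == g)]|.

Definition is_rds (G N : {group gT}) (R : {set gT}) (m n k : nat)
    (lambda : int) : Prop :=
  [/\ #|G| = (m * n)%N,
      N \subset G /\ #|N| = n,
      R \subset G /\ #|R| = k,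
      forall g, g \in G :\: N -> (diff_mult R g)%:Z = lambda
    & forall g, g \in N -> g != 1%g -> diff_mult R g = 0%N].

Section Characters.

Variable C : numClosedFieldType.

(* A homomorphism from G to C^*; only the values of chi on G matter. *)
Definition is_char (G : {group gT}) (chi : gT -> C) : Prop :=
  {in G, forall g, chi g != 0} /\
  {in G &, forall g h, chi (g * h)%g = chi g * chi h}.

(* Membership in N^\perp, inside the character group of G. *)
Definition in_perp (G N : {group gT}) (chi : gT -> C) : Prop :=
  is_char G chi /\ {in N, forall g, chi g = 1}.

Definition char_sum (chi : gT -> C) (R : {set gT}) : C :=
  \sum_(g in R) chi g.

End Characters.

End RelativeDifferenceSets.

(* Main.v *)
Require Import Defs.
From mathcomp Require Import all_boot all_order all_algebra all_fingroup.
From mathcomp Require Import separable cyclotomic mxrepresentation.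
From mathcomp Require Import ring reals.

(** The relative difference set condition is the identity
    [R R^(-1) = k + lambda (G - N)] in the group ring.  Each character [chi]
    turns it into [|chi(R)|^2 = k + lambda (chi(G) - chi(N))], whose right-hand
    side is evaluated by orthogonality; for [chi] trivial on [G] it is the
    counting identity [k (k - 1) = lambda n (m - 1)].  Conversely, characters
    separate group ring elements: the matrices of the regular representation of
    an abelian group commute and are diagonalizable, hence are simultaneously
    diagonalizable, and their diagonal entries are characters. *)

Set Implicit Arguments.
Unset Strict Implicit.
Unset Printing Implicit Defensive.

Import GRing.Theory Num.Theory.
Local Open Scope ring_scope.

(** The minimal polynomial of [A] divides ['X^e - 1], which splits over [C] and is separable because
    [e] is nonzero in characteristic 0. *)
Lemma expmx1_diagonalizable (C : numClosedFieldType) (n e : nat)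
    (A : 'M[C]_n.+1) :
  (0 < e)%N -> A ^+ e = 1 -> diagonalizable A.
Proof.
move=> e_gt0 Ae; apply/diagonalizableP.
have [rs Drs] := closed_field_poly_normal ('X^e - 1 : {poly C}).
move: Drs; rewrite lead_coefXnsubC // scale1r => Drs; exists rs.
  rewrite -separable_prod_XsubC -Drs.
  by apply: separable_Xn_sub_1; rewrite pnatr_eq0 -lt0n.
rewrite -Drs; apply: mxminpoly_min.
by rewrite rmorphB rmorphXn /= horner_mx_X Ae rmorph1 subrr.
Qed.

Lemma repr_mx_diagonalizable (C : numClosedFieldType) (gT : finGroupType)
    (G : {group gT}) (n : nat) (rG : mx_representation C G n) (g : gT) :
  g \in G -> diagonalizable (rG g).
Proof.
(* Powers of matrices live in the ring ['M_n.+1], so dimension 0 is treated apart. *)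
case: n rG => [|n] rG Gg.
  by exists 1%:M; rewrite ?unitmx1 //; apply/is_diag_mxP => -[].
apply: (@expmx1_diagonalizable _ _ #[g]%g) => //.
suff rGX e : rG (g ^+ e)%g = rG g ^+ e by rewrite -rGX expg_order repr_mx1.
elim: e => [|e IHe]; first exact: repr_mx1.
by rewrite exprS -IHe expgS repr_mxM // groupX.
Qed.

Lemma abelian_repr_codiagonalizable (C : numClosedFieldType)
    (gT : finGroupType) (G : {group gT}) (n : nat)
    (rG : mx_representation C G n) :
  abelian G -> codiagonalizable [seq rG g | g in G].
Proof.
move=> /centsP cGG; apply/codiagonalizableP.
split=> [_ _ /imageP[g Gg ->] /imageP[h Gh ->] | _ /imageP[g Gg ->]].
  by rewrite /comm_mx -!repr_mxM // (cGG g).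
exact: repr_mx_diagonalizable.
Qed.

Lemma char_separation (C : numClosedFieldType) (gT : finGroupType)
    (G : {group gT}) (f : gT -> C) :
    abelian G ->
    (forall chi : gT -> C, is_char G chi -> \sum_(g in G) f g * chi g = 0) ->
  {in G, forall g, f g = 0}.
Proof.
move=> abG f_perp.
pose rG := regular_repr C G.
have [P Pu /allP Pdiag] := abelian_repr_codiagonalizable rG abG.
pose D g := P *m rG g *m invmx P.
have Doff g i j : g \in G -> i != j -> D g i j = 0.
  move=> Gg ij; apply: (diagonalizable_forP _ Pu _) => //.
  by apply: Pdiag; apply: image_f.
have DM g h : g \in G -> h \in G -> D (g * h)%g = D g *m D h.
  by move=> Gg Gh; rewrite /D repr_mxM // !mulmxA mulmxKV.
have chiM i : {in G &, forall g h, D (g * h)%g i i = D g i i * D h i i}.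
  move=> g h Gg Gh; rewrite /= DM // mxE (bigD1 i) //= big1 ?addr0 // => j ji.
  by rewrite Doff ?mul0r // eq_sym.
have D1 : D 1%g = 1%:M by rewrite /D repr_mx1 mulmx1 mulmxV.
have chiP i : is_char G (fun g => D g i i).
  split=> [g Gg|]; last exact: chiM.
  (* A zero at [g] would force [D 1 i i], which is 1, to vanish. *)
  apply: contra_eq_neq (chiM i g g^-1%g Gg (groupVr Gg)) => ->.
  by rewrite mulgV D1 mxE eqxx mul0r oner_eq0.
have Df0 : \sum_(g in G) f g *: D g = 0.
  apply/matrixP=> i j; rewrite summxE mxE.
  have [<-|ij] := eqVneq i j.
    by rewrite -[RHS](f_perp _ (chiP i)); apply: eq_bigr => g _; rewrite mxE.
  by apply: big1 => g Gg; rewrite mxE Doff ?mulr0.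
(* Conjugation by the invertible [P] is injective, so the relation among the [D g] descends to the
   [rG g]. *)
have f0 : \sum_(g in G) f g *: rG g = 0.
  apply: (can_inj (mulKmx Pu)); apply: (can_inj (mulmxK (_ : invmx P \in unitmx))).
    by rewrite unitmx_inv.
  rewrite mulmx0 mul0mx mulmx_sumr mulmx_suml -[RHS]Df0.
  by apply: eq_bigr => g _; rewrite -scalemxAr -scalemxAl.
(* The matrices [rG h] are linearly independent: [gring_proj g] maps [rG g] to 1 and every other
   [rG h] to 0, which isolates [f g]. *)
move=> g Gg; have /(congr1 (@gring_proj C gT G g)) := f0.
rewrite linear_sum linear0 => /matrixP/(_ 0 0).
rewrite (bigD1 g) //= big1 => [|h /andP[Gh hg]]; last first.
  by rewrite linearZ /= gring_projE // eq_sym (negPf hg) scaler0.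
by rewrite linearZ /= gring_projE // eqxx !mxE mulr1 addr0.
Qed.

Section Characters.

Variables (C : numClosedFieldType) (gT : finGroupType) (G : {group gT}).
Variable chi : gT -> C.
Hypothesis chiP : is_char G chi.

Lemma is_char1 : chi 1%g = 1.
Proof.
have [nz_chi chiM] := chiP; apply: (mulfI (nz_chi _ (group1 G))).
by rewrite -chiM ?group1 // mulg1 mulr1.
Qed.

Lemma is_charX g e : g \in G -> chi (g ^+ e)%g = chi g ^+ e.
Proof.
have [_ chiM] := chiP; move=> Gg; elim: e => [|e IHe]; first exact: is_char1.
by rewrite expgS exprS chiM ?groupX // IHe.
Qed.

(** The value [chi g] is a root of unity, since [g] has finite order. *)
Lemma is_char_norm g : g \in G -> `|chi g| = 1.
Proof.
move=> Gg; apply/eqP; rewrite -(@pexpr_eq1 _ _ #[g]%g) // -normrX -is_charX //.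
by rewrite expg_order is_char1 normr1.
Qed.

Lemma is_charV g : g \in G -> chi g^-1%g = (chi g)^*.
Proof.
have [nz_chi chiM] := chiP.
move=> Gg; apply: (mulfI (nz_chi _ Gg)); rewrite -chiM ?groupV // mulgV.
by rewrite is_char1 -normCK is_char_norm // expr1n.
Qed.

Lemma char_sum_perp (H : {group gT}) :
  in_perp G H chi -> \sum_(h in H) chi h = #|H|%:R.
Proof.
case=> _ chi1; rewrite -sum1_card natr_sum.
by apply: eq_bigr => h /chi1.
Qed.

(** Pick [x] in [H] with [chi x != 1]. Translation by [x] permutes [H], so the sum [S] satisfies
    [chi x * S = S]. *)
Lemma char_sum_not_perp (H : {group gT}) :
  H \subset G -> ~ in_perp G H chi -> \sum_(h in H) chi h = 0.
Proof.
move=> /subsetP sHG nperp; have [_ chiM] := chiP.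
have [chi1|] := boolP [forall h in H, chi h == 1].
  by case: nperp; split=> // h Hh; apply/eqP/(forall_inP chi1).
case/forall_inPn=> x Hx chix; apply/eqP.
set S := \sum_(h in H) _; have : chi x * S == S.
  apply/eqP; rewrite mulr_sumr [RHS](reindex_inj (mulgI x)) /=.
  apply: eq_big => h; first by rewrite groupMl.
  by move=> Hh; rewrite chiM ?sHG.
by rewrite -subr_eq0 -{2}[S]mul1r -mulrBl mulf_eq0 subr_eq0 (negPf chix).
Qed.

Lemma char_sum_sqr (R : {set gT}) : R \subset G ->
  `|char_sum chi R| ^+ 2
    = #|R|%:R + \sum_(g in G) (diff_mult R g)%:R * chi g.
Proof.
move=> /subsetP sRG; have [_ chiM] := chiP.
rewrite normCK rmorph_sum big_distrlr /=.
(* The diagonal pairs contribute 1 each, giving [#|R|]; the remaining pairs are then grouped by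
   their quotient [x y^-1]. *)
have ->: \sum_(x in R) \sum_(y in R) chi x * (chi y)^*
    = \sum_(x in R) (1 + \sum_(y in R | y != x) chi x * (chi y)^*).
  apply: eq_bigr => x Rx; rewrite (bigD1 x Rx) /=.
  by rewrite -normCK is_char_norm ?sRG // expr1n.
rewrite big_split /= sumr_const; congr (_ + _); rewrite pair_big_dep /=.
rewrite (partition_big (fun p => p.1 * p.2^-1)%g (mem G)) /= => [|p]; last first.
  by case/and3P=> R1 R2 _; rewrite groupM ?groupV ?sRG.
apply: eq_bigr => g _; rewrite mulr_natl -sumr_const.
apply: eq_big => [p|p /andP[/and3P[R1 R2 _] /eqP <-]].
  by rewrite !inE (eq_sym p.2) !andbA.
by rewrite -is_charV ?sRG // -chiM ?groupV ?sRG.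
Qed.

End Characters.

(** [is_rds] constrains only the nonidentity elements of [N]; this supplies the value at the
    identity, making the condition uniform on [N]. *)
Lemma diff_mult1 (gT : finGroupType) (R : {set gT}) : diff_mult R 1%g = 0%N.
Proof.
apply/eqP; rewrite cards_eq0; apply/eqP/setP=> p; rewrite !inE.
by rewrite -eq_mulgV1 andNb andbF.
Qed.

Lemma diff_mult_char_sumP (C : numClosedFieldType) (gT : finGroupType)
    (G N : {group gT}) (R : {set gT}) (lambda : int) :
    abelian G -> N \subset G -> R \subset G ->
  {in G, forall g, (diff_mult R g)%:Z = if g \in N then 0 else lambda} <->
  (forall chi : gT -> C, is_char G chi ->
     `|char_sum chi R| ^+ 2
       = #|R|%:R + lambda%:~R * (\sum_(g in G) chi g - \sum_(g in N) chi g)).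
Proof.
move=> abG sNG sRG.
pose c g : C := (if g \in N then 0 else lambda)%:~R.
have cE (chi : gT -> C) : \sum_(g in G) c g * chi g
    = lambda%:~R * (\sum_(g in G) chi g - \sum_(g in N) chi g).
  rewrite (big_setID N) /= (setIidPr sNG) big1 => [|g Ng]; last first.
    by rewrite /c Ng mul0r.
  rewrite [in RHS](big_setID N) /= (setIidPr sNG) addrAC subrr !add0r mulr_sumr.
  by apply: eq_bigr => g /setDP[_ /negPf Ng]; rewrite /c Ng.
split=> [Rdiff chi chiP | Rchi g Gg].
  rewrite (char_sum_sqr chiP sRG) -cE; congr (_ + _).
  by apply: eq_bigr => g Gg; rewrite pmulrn Rdiff.
(* The difference of the two coefficient functions is orthogonal to every character, hence zero on
   [G]; integers embed injectively in [C]. *)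
apply: (@intr_inj C); apply/eqP; rewrite -subr_eq0; apply/eqP.
apply: (char_separation (f := fun g => (diff_mult R g)%:~R - c g) abG) => // chi chiP.
under eq_bigr => h _ do rewrite mulrBl.
rewrite sumrB cE; apply/eqP; rewrite subr_eq0.
by rewrite -(inj_eq (addrI #|R|%:R)) -Rchi // (char_sum_sqr chiP sRG).
Qed.

(* The field of complex numbers is RR[i] for RR a model of the reals. *)
Theorem theorem2p16 (RR : realType) (gT : finGroupType) (G N : {group gT})
    (R : {set gT}) (m n k : nat) (lambda : int)
    (G_abelian : abelian G) (G_order : #|G| = (m * n)%N)
    (N_sub_G : N \subset G) (N_order : #|N| = n)
    (R_sub_G : R \subset G) (R_card : #|R| = k)
    (param_eq : k%:Z * (k%:Z - 1) = lambda * n%:Z * (m%:Z - 1)) :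
  is_rds G N R m n k lambda <->
  (forall chi : gT -> RR[i], in_perp G N chi -> ~ in_perp G G chi ->
     `|char_sum chi R| ^+ 2 = k%:R - lambda%:~R * n%:R) /\
  (forall chi : gT -> RR[i], is_char G chi -> ~ in_perp G N chi ->
     `|char_sum chi R| ^+ 2 = k%:R).
Proof.
have sum_perp (chi : gT -> RR[i]) : is_char G chi -> in_perp G N chi ->
    ~ in_perp G G chi -> k%:R - lambda%:~R * n%:R
      = #|R|%:R + lambda%:~R * (\sum_(g in G) chi g - \sum_(g in N) chi g).
  move=> chiP perpN perpG.
  by rewrite (char_sum_perp perpN) (char_sum_not_perp chiP) // sub0r mulrN
             R_card N_order.
have sum_not_perp (chi : gT -> RR[i]) : is_char G chi -> ~ in_perp G N chi ->
    k%:R = #|R|%:R + lambda%:~R * (\sum_(g in G) chi g - \sum_(g in N) chi g).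
  move=> chiP perpN; have perpG : ~ in_perp G G chi.
    by case=> _ chi1; apply: perpN; split=> // g /(subsetP N_sub_G)/chi1.
  by rewrite !(char_sum_not_perp chiP) // subrr mulr0 addr0 R_card.
(* Triviality on [H] is a finite conjunction of decidable equalities, so the case split is
   constructive. *)
have perp_dec (chi : gT -> RR[i]) (H : {group gT}) :
    is_char G chi -> in_perp G H chi \/ ~ in_perp G H chi.
  move=> chiP; have [chi1|chiN1] := boolP [forall h in H, chi h == 1].
    by left; split=> // h Hh; apply/eqP/(forall_inP chi1).
  right=> -[_ chi1]; case/negP: chiN1; apply/forall_inP=> h Hh.
  by rewrite chi1.
have rdsP := diff_mult_char_sumP RR[i] lambda G_abelian N_sub_G R_sub_G.
split=> [[_ _ _ RdiffN Rdiff0] | [Rperp Rnperp]].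
  have /rdsP Rchi : {in G, forall g,
      (diff_mult R g)%:Z = if g \in N then 0 else lambda}.
    move=> g Gg; have [Ng|nNg] := boolP (g \in N).
      by have [->|g1] := eqVneq g 1%g; rewrite ?diff_mult1 ?Rdiff0.
    by rewrite RdiffN // inE nNg.
  split=> chi chiP nperp.
    by have [charP _] := chiP; rewrite Rchi // -sum_perp.
  by rewrite Rchi // -sum_not_perp.
have /rdsP Rdiff (chi : gT -> RR[i]) (chiP : is_char G chi) :
    `|char_sum chi R| ^+ 2
      = #|R|%:R + lambda%:~R * (\sum_(g in G) chi g - \sum_(g in N) chi g).
  have [perpN|nperpN] := perp_dec chi N chiP; last first.
    by rewrite Rnperp // -sum_not_perp.
  have [perpG|nperpG] := perp_dec chi G chiP; last first.
    by rewrite Rperp // -sum_perp.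
  (* For [chi] trivial on [G] neither hypothesis applies. The identity becomes
     [k^2 = k + lambda (m n - n)], a rearrangement of [param_eq]. *)
  have -> : char_sum chi R = k%:R.
    rewrite -R_card -sum1_card natr_sum; apply: eq_bigr => g Rg.
    by case: perpG => _ ->; rewrite ?(subsetP R_sub_G).
  rewrite (char_sum_perp perpG) (char_sum_perp perpN) R_card G_order N_order.
  rewrite normr_nat.
  have /(congr1 (fun z : int => z%:~R : RR[i])) := param_eq.
  rewrite !(rmorphM, rmorphB) /= !rmorph1 -!pmulrn => param_eqC.
  have -> : lambda%:~R * (m%:R * n%:R - n%:R)
      = lambda%:~R * n%:R * (m%:R - 1) :> RR[i] by ring.
  by rewrite -param_eqC; ring.
split=> // [g /setDP[Gg /negPf nNg] | g Ng _]; first by rewrite Rdiff ?nNg.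
by have := Rdiff g (subsetP N_sub_G g Ng); rewrite Ng => -[].
Qed.
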